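(* Let $\mathcal{X}=(\mathcal{V},\varrho,\upsilon)$ be a fuzzy tree whose underlying graph $\mathcal{X}^*=(\varrho^*,\upsilon^* )$ is not a tree. Then there exists at least one edge $uv\in\upsilon^*$ such that $SDI(\mathcal{X}\setminus uv)=SDI(\mathcal{X})$.
   Context: A fuzzy graph $\mathcal{X}=(\mathcal{V},\varrho,\upsilon)$ consists of a nonempty finite set $\mathcal{V}$ of vertices, a function $\varrho:\mathcal{V}\to[0,1]$ and a symmetric function $\upsilon:\mathcal{V}\times\mathcal{V}\to[0,1]$ with $\upsilon(ab)\le\min(\varrho(a),\varrho(b))$ for all $a,b$, and no loops ($\upsilon(aa)=0$). Put $\varrho^*=\{a:\varrho(a)>0\}$ and $\upsilon^*=\{ab:\upsilon(ab)>0\}$; it is assumed that $\mathcal{V}=\varrho^*$, and the elements of $\upsilon^*$ are called edges. $\mathcal{X}\setminus uv$ denotes the fuzzy graph obtained by deleting the edge $uv$ (setting $\upsilon(uv)=0$). A path is a sequence of distinct vertices $a_1,\dots,a_m$ with $\upsilon(a_ia_{i+1})>0$ for all $i<m$; its strength is the minimum of the weights $\upsilon$ of its edges. The strength of connectedness $\upsilon^\infty(a,b)$ between $a$ and $b$ is the maximum of the strengths of all paths from $a$ to $b$ (and $0$ if there is none). An edge $ab$ is strong if $\upsilon(ab)$ is at least the strength of connectedness between $a$ and $b$ in $\mathcal{X}\setminus ab$. A spanning fuzzy subgraph of $\mathcal{X}$ is a fuzzy graph $(\mathcal{V},\varrho,\tau)$ with $\tau\le\upsilon$ pointwise; it is a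 tree if its underlying graph is a tree. $\mathcal{X}$ is a fuzzy tree if it has a spanning fuzzy subgraph $\mathcal{F}=(\mathcal{V},\varrho,\tau)$ that is a tree and satisfies $\upsilon(ab)<\tau^\infty(a,b)$ for all $ab\in\upsilon^*\setminus\tau^*$, where $\tau^\infty$ is the strength of connectedness in $\mathcal{F}$. A set $\mathcal{D}\subseteq\mathcal{V}$ is a strong dominating set (SDS) if every $b\in\mathcal{V}\setminus\mathcal{D}$ is joined by a strong edge to some $a\in\mathcal{D}$. An SDS $\mathcal{D}$ is a minimal strong dominating set (MSDS) if $\mathcal{D}\setminus\{a\}$ is not an SDS for every $a\in\mathcal{D}$. The weight of $\mathcal{S}\subseteq\mathcal{V}$ is $W(\mathcal{S})=\sum_{a\in\mathcal{S}}\min\{\upsilon(ab): ab \text{ is a strong edge}\}$. The strong domination degree ${}_{sd}d(u)$ of a vertex $u$ is the minimum of the weights of the MSDSs containing $u$; the strong domination index is $SDI(\mathcal{X})=\sum_{v\in\mathcal{V}}{}_{sd}d(v)$. *)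

(* Defs.v *)
From mathcomp Require Import all_boot all_order all_algebra.

Set Implicit Arguments.
Unset Strict Implicit.
Unset Printing Implicit Defensive.

Import Order.TTheory GRing.Theory Num.Theory.
Local Open Scope ring_scope.

(* Vertex weights may vanish here; the standing assumption that every vertex
   has positive weight is a separate hypothesis. *)
Record fuzzy_graph (R : realFieldType) (V : finType) := FuzzyGraph {
  vweight : V -> R;
  eweight : V -> V -> R;
  vertices_gt0 : (0 < #|V|)%N;
  vweight_itv : forall a, 0 <= vweight a <= 1;
  eweight_itv : forall a b, 0 <= eweight a b <= 1;
  eweight_sym : forall a b, eweight a b = eweight b a;
  eweight_le : forall a b, eweight a b <= Num.min (vweight a) (vweight b);
  eweight_loop : forall a, eweight a a = 0
}.

(* The minimum of an empty sequence is set to 0. *)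
Definition seqmin (R : realFieldType) (s : seq R) : R :=
  if s is x :: s' then \big[Num.min/x]_(y <- s') y else 0.

Definition is_tree (V : finType) (e : rel V) : Prop :=
  (forall a b, connect e a b) /\
  ~ (exists s : seq V, (2 < size s)%N /\ ucycle e s).

Section FuzzyGraph.
Variables (R : realFieldType) (V : finType).
Implicit Types (X F : fuzzy_graph R V) (a b u v : V) (D S : {set V}).

Definition edge X : rel V := fun a b => 0 < eweight X a b.

Section Delete.
Variables (X : fuzzy_graph R V) (u v : V).

Definition del_weight a b : R :=
  if (a == u) && (b == v) || (a == v) && (b == u) then 0 else eweight X a b.

Fact del_weight_itv a b : 0 <= del_weight a b <= 1.
Proof. by rewrite /del_weight; case: ifP; rewrite ?eweight_itv // lexx ler01. Qed.

Fact del_weight_sym a b : del_weight a b = del_weight b a.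
Proof.
by rewrite /del_weight orbC (andbC (a == v)) (andbC (a == u)) eweight_sym.
Qed.

Fact del_weight_le a b :
  del_weight a b <= Num.min (vweight X a) (vweight X b).
Proof.
rewrite /del_weight; case: ifP => _; last exact: eweight_le.
have /andP[a0 _] := vweight_itv X a; have /andP[b0 _] := vweight_itv X b.
by rewrite le_min a0 b0.
Qed.

Fact del_weight_loop a : del_weight a a = 0.
Proof. by rewrite /del_weight eweight_loop if_same. Qed.

Definition del_edge : fuzzy_graph R V :=
  FuzzyGraph (vertices_gt0 X) (vweight_itv X)
    del_weight_itv del_weight_sym del_weight_le del_weight_loop.

End Delete.

(* The path is a :: p; its vertices are distinct, so it is no restriction to
   bound the size of p by #|V| when ranging over all paths. *)
Definition is_path X a b (p : seq V) : bool :=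
  [&& path (edge X) a p, uniq (a :: p) & last a p == b].

Definition strength X a (p : seq V) : R := seqmin (pairmap (eweight X) a p).

Definition conn X a b : R :=
  \big[Num.max/0]_(p : #|V|.-bseq V | is_path X a b p) strength X a p.

Definition strong_edge X : rel V :=
  fun a b => edge X a b && (conn (del_edge X a b) a b <= eweight X a b).

Definition spanning_subgraph F X : Prop :=
  (forall a, vweight F a = vweight X a) /\
  (forall a b, eweight F a b <= eweight X a b).

Definition fuzzy_tree X : Prop :=
  exists F, [/\ spanning_subgraph F X, is_tree (edge F) &
    forall a b, edge X a b -> ~~ edge F a b -> eweight X a b < conn F a b].

Definition SDS X D : bool :=
  [forall (b | b \notin D), exists a in D, strong_edge X a b].

Definition MSDS X D : bool := SDS X D && [forall a in D, ~~ SDS X (D :\ a)].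

Definition weight X S : R :=
  \sum_(a in S) seqmin [seq eweight X a b | b in strong_edge X a].

(* Every vertex lies in some MSDS (a maximal set containing it and without strong
   edges), so this minimum is never over the empty sequence. *)
Definition sd_degree X u : R :=
  seqmin [seq weight X D | D in [set D | MSDS X D & u \in D]].

Definition SDI X : R := \sum_v sd_degree X v.

End FuzzyGraph.

(* Main.v *)
Require Import Defs.
From mathcomp Require Import all_boot all_order all_algebra.

Import Order.TTheory GRing.Theory Num.Theory.
Local Open Scope ring_scope.

(** The strong edges of a fuzzy tree are exactly the edges of its spanning tree
    F.  An edge ab outside F is weaker than the F-path from a to b, which avoids
    ab.  Conversely, removing an edge ab of F splits V into two parts; a path of
    X \ ab from a to b crosses between them along an edge xy outside F, and the
    F-path from x to y has to use ab, so xy is weaker than ab.  Deleting an edge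
    uv outside F leaves F a witness that X \ uv is a fuzzy tree, hence changes
    neither the strong edges nor their weights. *)

(** The empty sequence is excluded because its [seqmin] is the default 0. *)
Lemma le_seqmin (R : realFieldType) (z : R) (s : seq R) :
  s != [::] -> (z <= seqmin s) = all (>= z) s.
Proof.
case: s => // x s _ /=; elim: s => [|y s IHs] /=.
  by rewrite big_nil andbT.
by rewrite big_cons le_min IHs andbCA.
Qed.

Lemma seqmin_le (R : realFieldType) (z : R) (s : seq R) :
  z \in s -> seqmin s <= z.
Proof.
move=> zs; have s0 : s != [::] by case: s zs.
by have := lexx (seqmin s); rewrite le_seqmin // => /allP; apply.
Qed.

Lemma eq_is_tree (V : finType) (e e' : rel V) :
  e =2 e' -> is_tree e -> is_tree e'.
Proof.
move=> ee' [conn_e acyc_e]; split=> [a b|[s [s2 /andP[cs us]]]].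
  by rewrite -(eq_connect ee').
by apply: acyc_e; exists s; split; rewrite // /ucycle (eq_cycle ee') cs.
Qed.

(* As the direct step ab is excluded, a path from a to b closes up to a cycle. *)
Lemma tree_edge_bridge {V : finType} {e : rel V} {a b : V} :
    symmetric e -> is_tree e -> e a b -> a != b ->
  ~~ connect
    [rel x y | e x y && ~~ ((x == a) && (y == b) || (x == b) && (y == a))] a b.
Proof.
move=> esym [_ acyc] eab aNb; apply/negP => /connectP[p0 p0P p0b].
move: p0b; case/shortenP: p0P => p pP pu _ pb.
apply: acyc; exists (a :: p); split.
  (* The cycle has at least three vertices: [p] is nonempty as [a != b], and is not [b] alone as the
     step ab is excluded. *)
  case: p pP pb {pu} => [|x [|y p]] //=.
    by move=> _ ba; rewrite ba eqxx in aNb.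
  by move=> + bx; rewrite -bx !eqxx andbF.
rewrite /ucycle pu andbT /= rcons_path -pb esym eab andbT.
by apply: sub_path pP => x y /andP[].
Qed.

Section Strength.
Context {R : realFieldType} {V : finType}.
Implicit Types (X F : fuzzy_graph R V) (a b : V).

Lemma edge_sym X : symmetric (edge X).
Proof. by move=> a b; rewrite /edge eweight_sym. Qed.

Lemma edgeN_eq0 X a b : ~~ edge X a b -> eweight X a b = 0.
Proof.
rewrite /edge -leNgt => le0; apply/eqP; rewrite eq_le le0.
by case/andP: (eweight_itv X a b).
Qed.

(** A path that starts in [S] and ends outside has a first step leaving [S], whose weight is among
    those minimized. *)
Lemma strength_crossing {X} {S : pred V} {a} {p : seq V} :
    path (edge X) a p -> S a -> ~~ S (last a p) ->
  exists x y, [/\ S x, ~~ S y, edge X x y & strength X a p <= eweight X x y].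
Proof.
move=> pP aS bNS.
suff [x [y [xS yNS xy xyp]]] : exists x y,
    [/\ S x, ~~ S y, edge X x y & eweight X x y \in pairmap (eweight X) a p].
  by exists x, y; split=> //; apply: seqmin_le.
elim: p a aS pP bNS => [|c p IHp] a aS /=; first by rewrite aS.
case/andP=> ac cp bNS; have [cS|cNS] := boolP (S c).
  have [x [y [xS yNS xy xyp]]] := IHp c cS cp bNS.
  by exists x, y; split; rewrite // inE xyp orbT.
by exists a, c; rewrite aS cNS ac mem_head.
Qed.

Lemma le_strength {F X} a p : (forall x y, eweight F x y <= eweight X x y) ->
  strength F a p <= strength X a p.
Proof.
move=> leFX; have all_le z q c : all (>= z) (pairmap (eweight F) c q) ->
    all (>= z) (pairmap (eweight X) c q).
  elim: q c => //= d q IHq c /andP[zF /IHq ->].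
  by rewrite (le_trans zF).
(* The empty path has strength 0 in both graphs. *)
case: p => // b p; rewrite /strength.
by rewrite le_seqmin // all_le // -le_seqmin.
Qed.

Lemma le_conn {F X} a b : (forall x y, eweight F x y <= eweight X x y) ->
  conn F a b <= conn X a b.
Proof.
move=> leFX; apply/bigmax_leP; split=> [|p /and3P[pP pu pb]].
  exact: bigmax_ge_id.
apply: le_trans (le_strength a p leFX) _; apply: le_bigmax_cond.
rewrite /is_path pu pb !andbT; apply: sub_path pP => x y xy.
exact: lt_le_trans xy (leFX x y).
Qed.

(** Every path from a to b crosses the cut [S]. The bound [0 <= z] covers the value 0 of [conn] when
    there is no path. *)
Lemma conn_cut_le {X} {S : pred V} {a b} {z : R} :
    0 <= z -> S a -> ~~ S b ->
    (forall x y, S x -> ~~ S y -> edge X x y -> eweight X x y <= z) ->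
  conn X a b <= z.
Proof.
move=> z0 aS bNS cut; apply/bigmax_leP; split=> // p /and3P[pP _ /eqP pb].
rewrite -pb in bNS.
have [x [y [xS yNS xy lexy]]] := strength_crossing pP aS bNS.
exact: le_trans lexy (cut x y xS yNS xy).
Qed.

Lemma strong_edge_tree {X F} :
    (forall a b, eweight F a b <= eweight X a b) -> is_tree (edge F) ->
    (forall a b, edge X a b -> ~~ edge F a b -> eweight X a b < conn F a b) ->
  strong_edge X =2 edge F.
Proof.
move=> leFX treeF domF a b; rewrite /strong_edge.
have [Fab|NFab] := boolP (edge F a b); last first.
  have [Xab /=|//] := boolP (edge X a b); apply/negbTE; rewrite -ltNge.
  (* F vanishes on ab, so it still lies below X with ab deleted. *)
  apply: lt_le_trans (domF a b Xab NFab) _; apply: le_conn => x y /=.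
  rewrite /del_weight; case: ifP => // /orP[] /andP[/eqP-> /eqP->].
    by rewrite edgeN_eq0.
  by rewrite eweight_sym edgeN_eq0.
have Xab : edge X a b by apply: lt_le_trans Fab (leFX a b).
have aNb : a != b.
  by apply/eqP=> ab; move: Fab; rewrite ab /edge eweight_loop ltxx.
rewrite Xab /=.
set e := [rel x y | edge F x y &&
  ~~ ((x == a) && (y == b) || (x == b) && (y == a))].
(* The cut is the component of a in F minus ab; ab is the only edge of F that leaves it. *)
have crossF x y : connect e a x -> ~~ connect e a y -> edge F x y ->
    (x == a) && (y == b) || (x == b) && (y == a).
  move=> ax + Fxy; apply: contraNT => Nxy.
  by apply: connect_trans ax (connect1 _); rewrite /= Fxy.
have bridge := tree_edge_bridge (edge_sym F) treeF Fab aNb.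
apply: (conn_cut_le (ltW Xab) (connect0 e a) bridge) => x y ax Nay.
rewrite /edge /= /del_weight; case: ifP => [|Nxy Xxy]; first by rewrite ltxx.
have NFxy : ~~ edge F x y by apply/negP=> /(crossF x y ax Nay); rewrite Nxy.
apply: le_trans (ltW (domF x y Xxy NFxy)) (le_trans _ (leFX a b)).
(* The same cut, now in F, separates x from y. *)
apply: (conn_cut_le (ltW Fab) ax Nay) => x' y' ax' Nay' /(crossF _ _ ax' Nay').
by case/orP=> /andP[/eqP-> /eqP->]; rewrite // eweight_sym.
Qed.

(** Domination and vertex weights only see strong edges, so weights need to agree on these alone. *)
Lemma eq_SDI {X Y : fuzzy_graph R V} :
    strong_edge X =2 strong_edge Y ->
    (forall a b, strong_edge X a b -> eweight X a b = eweight Y a b) ->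
  SDI X = SDI Y.
Proof.
move=> eqs eqw.
have eqSDS D : SDS X D = SDS Y D.
  apply: eq_forallb => b; congr (_ ==> _).
  by apply: eq_existsb => a; rewrite eqs.
have eqMSDS D : MSDS X D = MSDS Y D.
  by rewrite /MSDS eqSDS; congr andb; apply: eq_forallb => a; rewrite eqSDS.
have eqW D : weight X D = weight Y D.
  apply: eq_bigr => a _; congr seqmin.
  transitivity [seq eweight Y a b | b in strong_edge X a].
    by apply/eq_in_map => b; rewrite mem_enum => /eqw.
  by apply: eq_image => // b; apply: eqs.
apply: eq_bigr => u _; congr seqmin; apply: eq_image => // D.
by rewrite !inE eqMSDS.
Qed.

End Strength.

Theorem theorem4p17 (R : realFieldType) (V : finType) (X : fuzzy_graph R V)
    (Xsupp : forall a : V, 0 < vweight X a)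
    (Xtree : fuzzy_tree X)
    (Xntree : ~ is_tree (edge X)) :
  exists u v : V, edge X u v /\ SDI (del_edge X u v) = SDI X.
Proof.
have [F [[_ leFX] treeF domF]] := Xtree.
have [/existsP[u /existsP[v /andP[Xuv NFuv]]]|none] :=
    boolP [exists u, exists v, edge X u v && ~~ edge F u v]; last first.
  (* If every edge of X were in F, both would have the same underlying graph, a tree. *)
  case: Xntree; apply: eq_is_tree treeF => a b.
  apply/idP/idP => [Fab|Xab]; first exact: lt_le_trans Fab (leFX a b).
  apply: contraNT none => NFab.
  apply/existsP; exists a; apply/existsP; exists b.
  by rewrite Xab.
have delE a b : edge F a b -> eweight (del_edge X u v) a b = eweight X a b.
  rewrite /= /del_weight; case: ifP => // uv Fab; case/negP: NFuv.
  by move: uv Fab => /orP[] /andP[/eqP-> /eqP->] //; rewrite edge_sym.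
have le_del a b : eweight (del_edge X u v) a b <= eweight X a b.
  by rewrite /= /del_weight; case: ifP => // _; case/andP: (eweight_itv X a b).
have leF a b : eweight F a b <= eweight (del_edge X u v) a b.
  have [/delE ->//|/edgeN_eq0 ->] := boolP (edge F a b).
  by case/andP: (eweight_itv (del_edge X u v) a b).
have strongX := strong_edge_tree leFX treeF domF.
have strongD : strong_edge (del_edge X u v) =2 edge F.
  (* Domination by F persists: [conn F] is unchanged and the weights of X can only drop. *)
  apply: strong_edge_tree => // a b Dab NFab.
  apply: le_lt_trans (le_del a b) (domF a b _ NFab).
  by apply: lt_le_trans Dab _.
exists u, v; split=> //; apply: eq_SDI => [a b|a b].
  by rewrite strongD strongX.
by rewrite strongD => /delE.
Qed.
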